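(* Let $G$ be a finite group and let $V$ be a finite faithful $G$-module of characteristic $p$. Let $v\in V$ and put $C=C_G(v)$. Let $c_1=1,c_2,\dots,c_{k(C)}$ be representatives of the conjugacy classes of $C$. Then the following hold. (a) If $(|C|,|V|)=1$, then $$|\mathrm{Irr}_0(GV)|\leq\sum_{i=1}^{k(C)}|C_V(c_i)|,$$ and if moreover $C>1$, then $$|\mathrm{Irr}_0(GV)|\leq\max\left\{\frac{2}{|C|}\sum_{i=1}^{k(C)}|C_V(c_i)|,\ \frac{2|C|}{k(C)-1}\sum_{i=2}^{k(C)}|C_V(c_i)|\right\}.$$ (b) If $(|G|,|V|)=1$, then $\mathrm{Irr}_0(GV)=\mathrm{Irr}(GV)$, so $k(GV)=|\mathrm{Irr}_0(GV)|$, and the bounds in (a) hold with $k(GV)$ in place of $|\mathrm{Irr}_0(GV)|$. (c) In general (with no coprimeness assumption), if $g\in C$ is an element whose order $o(g)=q$ is a prime, then $$|\mathrm{Irr}_{p'}(GV)|\leq k(GV,v)\leq\frac{1}{q}\Big(|N_G(\langle v\rangle)|\,|V|+(q-1)\,p\,|N_G(\langle g\rangle)|\,|C_V(g)|\Big).$$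
   Context: A finite $G$-module of characteristic $p$ ($p$ a prime) is a finite vector space over a field of characteristic $p$ on which $G$ acts linearly. $GV$ denotes the semidirect product of $V$ by $G$, with $G$ and $V$ regarded as subgroups. $\mathrm{Irr}(X)$ is the set of irreducible complex characters and $k(X)$ the number of conjugacy classes of a finite group $X$. $C_G(v)$ is the stabilizer of $v$ in $G$, $C_V(c)$ is the set of fixed points of $c$ in $V$, $N_G(\langle v\rangle)$ is the set of elements of $G$ mapping the subgroup $\langle v\rangle$ of $V$ to itself, and $N_G(\langle g\rangle)$ is the usual normalizer. Put $A=\langle v\rangle$ and let $\rho_A$ be the regular character of $A$. Since $C=C_G(v)$ centralizes $A$, $C\times A$ is a subgroup of $GV$. $\mathrm{Irr}_0(GV)$ (which depends on $v$) denotes the set of all $\chi\in\mathrm{Irr}(GV)$ for which there is no character $\tau$ of $C$ with $\chi|_{C\times A}=\tau\times\rho_A$. $\mathrm{Irr}_{p'}(GV)$ denotes the set of all $\chi\in\mathrm{Irr}(GV)$ such that $p$ does not divide $\chi(1)$. $k(GV,v)$ denotes the number of $\chi\in\mathrm{Irr}(GV)$ such that $\chi|_{\langle v\rangle}$ is not an integer multiple of the regular character of $\langle v\rangle$.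
   Formalization: The formal statement assumes v ≠ 0 in (b) and in the left inequality of (c), since for v = 0 the set Irr_0(GV) is empty and k(GV,v) = 0, although the trivial character lies in Irr(GV) and Irr_{p'}(GV). *)

(* Defs.v *)
From mathcomp Require Import all_boot all_order all_fingroup all_algebra.
From mathcomp Require Import all_solvable all_field all_character.
From mathcomp Require Import boolp.

Set Implicit Arguments.
Unset Strict Implicit.
Unset Printing Implicit Defensive.

Import GroupScope GRing.Theory.
Local Open Scope ring_scope.

(* [c 1], ..., [c k], with k = k(C), represent the conjugacy classes of C and
   [c 1] is the identity; the values of [c] outside 1..k are irrelevant. *)
Definition class_representatives (gT : finGroupType) (C : {group gT})
    (c : nat -> gT) : Prop :=
  [/\ c 1%N = 1%g,
      forall i : nat, (1 <= i <= #|classes C|)%N -> c i \in C &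
      forall x : gT, x \in C ->
        exists! i : nat, (1 <= i <= #|classes C|)%N /\ x \in c i ^: C].

Section SemidirectProduct.

Context {gT : finGroupType} {G : {group gT}} {F : fieldType}.
Context {V : finLmodType F} (to : groupAction G [set: V]).

(* A [groupAction] already acts by automorphisms of the additive group. *)
Definition acts_linearly : Prop :=
  forall g, g \in G -> linear (fun u : V => to u g).

Definition semidirect : {group sdprod_by to} := [set: sdprod_by to]%G.

Variable v : V.

(* C_G(v) and <v> as subgroups of GV. *)
Definition stab_in : {group sdprod_by to} := (sdpair2 to @* 'C_G[v | to])%G.
Definition cycle_in : {group sdprod_by to} := (sdpair1 to @* <[v]>)%G.

Lemma stab_cycle_dprod : stab_in \x cycle_in = stab_in <*> cycle_in.
Proof.
rewrite dprodEY //=.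
  rewrite morphim_cycle ?inE // cycle_subG; apply/centP => y.
  case/morphimP => g Gg; rewrite inE => /andP[_ cgv] ->.
  apply/commgP/conjg_fixP; rewrite -sdpair_act ?inE //.
  by rewrite (astab_act cgv) ?set11.
apply/trivgP; rewrite -(im_sdpair_TI to) setIC.
by apply: setISS; rewrite morphimS // ?subsetIl ?subsetT.
Qed.

(* The chi in Irr(GV) for which no character tau of C satisfies
   chi|_(C x A) = tau x rho_A, where A = <v>. *)
Definition Irr0 : {set Iirr semidirect} :=
  [set i | ~~ `[< exists2 tau : 'CF(stab_in), tau \is a character &
                  'Res[stab_in <*> cycle_in] 'chi[semidirect]_i
                    = cfDprod stab_cycle_dprod tau (cfReg cycle_in) >]].

Definition Irr_not_regular : {set Iirr semidirect} :=
  [set i | ~~ `[< exists m : int,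
                  'Res[cycle_in] 'chi[semidirect]_i
                    = cfReg cycle_in *~ m >]].

(* k(GV, v) *)
Definition class_number_at : nat := #|Irr_not_regular|.

End SemidirectProduct.

Definition Irr_p' (gT : finGroupType) (X : {group gT}) (p : nat) :
    {set Iirr X} :=
  [set i | ~~ (p %| 'chi[X]_i 1%g)%C].

(* Main.v *)
(* Let D <= C and restrict chi in Irr(GV) to D x A, where A = <v>; write the
   restriction as the sum of m(i,j) psi_i x lambda_j.  It is of the form
   tau x rho_A exactly when all columns of m agree.  By Parseval, the sum of
   |chi(da)|^2 over d in D and a in A - {1} is |D| times
   P = (1/2) sum_(j,k) sum_i (m(i,j) - m(i,k))^2, an integer which is at least
   |A| - 1 as soon as two columns differ, because a non-constant function on a
   set of size n separates at least n - 1 pairs.  The same sum restricted to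
   d != 1 is, by Lagrange's identity, the integer
   Q = (1/4) sum_(j,k) sum_(i,l) (t_i psi_l(1) - t_l psi_i(1))^2 with
   t_i = m(i,j) - m(i,k); either some column difference t is not proportional
   to the degrees, so that Q >= (|A| - 1)(k(D) - 1), or P >= |D|(|A| - 1).
   Summing over chi, second orthogonality turns |chi(da)|^2 into
   |C_GV(da)|, which is at most |C_G(d)||C_V(d)|, and at most |C_C(d)||C_V(d)|
   when d and a have coprime orders.  Parts (a) and (b) take D = C, part (c)
   takes D = <g>.  In (b) no chi vanishes at v: otherwise Clifford's theorem
   gives a vanishing sum of p-th roots of unity with a number of terms prime
   to p. *)

Require Import Defs.
From mathcomp Require Import all_boot all_order all_fingroup all_algebra.
From mathcomp Require Import all_solvable all_field all_character.
From mathcomp Require Import boolp ring lra zify.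

Set Implicit Arguments.
Unset Strict Implicit.
Unset Printing Implicit Defensive.

Import Order.TTheory GroupScope GRing.Theory Num.Theory.
Local Open Scope ring_scope.

(** * Variation of the columns of an integer matrix *)

(** The s indices that share the value of [i0] each differ from the other t, and each of those t
    differs from at least s. This gives 2st ordered pairs, and st >= s + t - 1 since s, t >= 1. *)
Lemma sum_card_neq_ge (I : finType) (T : eqType) (h : I -> T) (i0 j0 : I) :
  h i0 != h j0 ->
  (2 * #|I|.-1 <= \sum_(i : I) #|[pred j | h i != h j]|)%N.
Proof.
move=> hij; set B := [pred j | h i0 == h j]; set s := #|B|.
have sC : (s + #|predC B| = #|I|)%N by rewrite cardC.
have s0 : (0 < s)%N by apply/card_gt0P; exists i0; rewrite inE.
have t0 : (0 < #|predC B|)%N by apply/card_gt0P; exists j0; rewrite !inE.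
have leB i : i \in B -> (#|predC B| <= #|[pred j | h i != h j]|)%N.
  by move=> /eqP <-.
have leC i : i \in predC B -> (s <= #|[pred j | h i != h j]|)%N.
  move=> Bi; apply: subset_leq_card; apply/subsetP=> j; rewrite !inE => /eqP <-.
  by rewrite eq_sym.
rewrite (bigID (mem B)) /=.
have := leq_add (leq_sum (index_enum I) leB) (leq_sum (index_enum I) leC).
rewrite !sum_nat_const -/s => le1; apply: leq_trans _ le1; rewrite -sC.
move: s0 t0; case: (s) => // a _; case: #|predC B| => // b _; nia.
Qed.

(** Meant for [w] a sum of integer squares, bounded below by [c] wherever the labels [h] differ. *)
Lemma sum_pairs_ge (R : numDomainType) (I : finType) (T : eqType) (h : I -> T)
    (w : I -> I -> R) (c : R) (i0 j0 : I) :
    0 <= c -> (forall i j, 0 <= w i j) ->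
    (forall i j, h i != h j -> c <= w i j) -> h i0 != h j0 ->
  c *+ (2 * #|I|.-1) <= \sum_i \sum_j w i j.
Proof.
move=> c0 w0 wc hij.
have le1 : \sum_(i : I) c *+ #|[pred j | h i != h j]| <= \sum_i \sum_j w i j.
  apply: ler_sum => i _; rewrite [leRHS](bigID [pred j | h i != h j]) /=.
  rewrite -[leLHS]addr0 lerD ?sumr_ge0 // -sumr_const.
  by apply: ler_sum => j; apply: wc.
apply: le_trans le1; rewrite sumrMnr; apply: ler_wpMn2l => //.
exact: sum_card_neq_ge hij.
Qed.

Lemma lagrange_identity (R : comRingType) (I : finType) (x y : I -> R) :
  \sum_i \sum_j (x i * y j - x j * y i) ^+ 2
    = ((\sum_i x i ^+ 2) * (\sum_i y i ^+ 2) - (\sum_i x i * y i) ^+ 2) *+ 2.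
Proof.
(* All monomials of the expanded square belong to one family indexed by exponents, so a single
   factorization [sumf] serves them all. *)
pose f u v i j := (x i ^+ u * y i ^+ v) * (x j ^+ (2 - u) * y j ^+ (2 - v)).
transitivity (\sum_i \sum_j (f 2 0 i j + f 0 2 i j - f 1 1 i j *+ 2)).
  by apply: eq_bigr => i _; apply: eq_bigr => j _; rewrite /f; ring.
have sumf u v : \sum_i \sum_j f u v i j
    = (\sum_i x i ^+ u * y i ^+ v) * (\sum_i x i ^+ (2 - u) * y i ^+ (2 - v)).
  by rewrite big_distrlr.
under eq_bigr do rewrite big_split sumrN /= big_split /= sumrMnl.
rewrite big_split sumrN /= big_split sumrMnl /= !sumf /=.
transitivity ((\sum_i x i ^+ 2) * (\sum_i y i ^+ 2)
    + (\sum_i y i ^+ 2) * (\sum_i x i ^+ 2)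
    - ((\sum_i x i * y i) * (\sum_i x i * y i)) *+ 2); last by ring.
by congr (_ * _ + _ * _ - (_ * _) *+ 2); apply: eq_bigr => i _;
  rewrite ?subn0 ?subnn ?expr0 ?expr1 ?mulr1 ?mul1r.
Qed.

Lemma sum_sqr_diff (R : comRingType) (J : finType) (x : J -> R) :
  \sum_j \sum_k (x j - x k) ^+ 2
    = (#|J|%:R * \sum_j x j ^+ 2 - (\sum_j x j) ^+ 2) *+ 2.
Proof.
transitivity (\sum_j \sum_k (x j * 1 - x k * 1) ^+ 2).
  by apply: eq_bigr => j _; apply: eq_bigr => k _; rewrite !mulr1.
rewrite (lagrange_identity x (fun=> 1)) expr1n sumr_const mulrC.
by under [\sum_i x i * 1]eq_bigr do rewrite mulr1.
Qed.

Section ColumnVariation.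

Variables (I J : finType) (m : I -> J -> algC) (y : I -> algC) (i1 : I).
Hypothesis Zm : forall i j, m i j \is a Num.int.
Hypothesis Zy : forall i, y i \is a Num.int.
Hypothesis y0 : forall i, y i != 0.
Hypothesis y1 : y i1 = 1.

(** The quantity P of the opening sketch, in the form that Parseval produces; [col_varE] identifies
    it with half the sum of squared distances between columns. *)
Definition col_var :=
  \sum_i (#|J|%:R * (\sum_j m i j ^+ 2) - (\sum_j m i j) ^+ 2).

Definition weighted_col j := \sum_i m i j * y i.

(** The quantity Q of the opening sketch, again in Parseval form; [transverse_varE] shows the sum of
    squares behind it. *)
Definition transverse_var :=
  (\sum_i y i ^+ 2) * col_var
    - (#|J|%:R * (\sum_j weighted_col j ^+ 2) - (\sum_j weighted_col j) ^+ 2).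

Lemma col_varE :
  \sum_j \sum_k \sum_i (m i j - m i k) ^+ 2 = col_var *+ 2.
Proof.
rewrite /col_var -sumrMnl; under eq_bigr do rewrite exchange_big.
rewrite exchange_big; apply: eq_bigr => i _ /=; exact: sum_sqr_diff.
Qed.

Lemma transverse_varE :
  \sum_j \sum_k \sum_i \sum_l
     ((m i j - m i k) * y l - (m l j - m l k) * y i) ^+ 2
    = transverse_var *+ 4.
Proof.
under eq_bigr => j _ do under eq_bigr => k _ do
  rewrite (lagrange_identity (fun i => m i j - m i k) y).
transitivity (\sum_j \sum_k ((\sum_i (m i j - m i k) ^+ 2) * (\sum_i y i ^+ 2)
       - (weighted_col j - weighted_col k) ^+ 2) *+ 2).
  apply: eq_bigr => j _; apply: eq_bigr => k _; congr ((_ - _ ^+ 2) *+ 2).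
  by rewrite /weighted_col -sumrB; apply: eq_bigr => i _; rewrite mulrBl.
under eq_bigr do rewrite sumrMnl sumrB -mulr_suml.
rewrite sumrMnl sumrB -mulr_suml col_varE sum_sqr_diff /transverse_var.
ring.
Qed.

Lemma sqr_int_ge0 (x : algC) : x \is a Num.int -> 0 <= x ^+ 2.
Proof. by move=> Zx; rewrite -intr_normK // exprn_ge0. Qed.

Lemma sum_sqr_int_ge1 (f : I -> algC) (i : I) :
  (forall i, f i \is a Num.int) -> f i != 0 -> 1 <= \sum_i f i ^+ 2.
Proof.
move=> Zf fi; rewrite (bigD1 i) //= -[leLHS]addr0 lerD ?sqr_intr_ge1 //.
by apply: sumr_ge0 => l _; apply: sqr_int_ge0.
Qed.

Variables (i0 : I) (j0 j1 : J).
Hypothesis mj : m i0 j0 != m i0 j1.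

(** Columns are packed as finite functions to serve as labels with decidable equality in
    [sum_pairs_ge]. *)
Let col j : {ffun I -> algC} := [ffun i => m i j].

Let colP j k : col j != col k -> exists i, m i j != m i k.
Proof.
move=> njk; apply/existsP; apply: contraR njk => /existsPn eqjk.
by apply/eqP/ffunP=> i; rewrite !ffunE; apply/eqP; rewrite -[_ == _]negbK eqjk.
Qed.

Let col01 : col j0 != col j1.
Proof. by apply: contraNneq mj => /ffunP/(_ i0); rewrite !ffunE => ->. Qed.

Lemma col_var_ge : #|J|.-1%:R <= col_var.
Proof.
rewrite -(@ler_pMn2r _ 2) // -col_varE -mulrnA mulnC.
apply: sum_pairs_ge col01 => // [j k|j k /colP[i mi]].
  by apply: sumr_ge0 => i _; rewrite sqr_int_ge0 ?rpredB.
apply: (@sum_sqr_int_ge1 (fun i => m i j - m i k) i) => [i'|].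
  by rewrite rpredB.
by rewrite subr_eq0.
Qed.

(* Either two columns differ by a vector that is not proportional to [y], which
   makes the transverse variation large, or all differences are integer
   multiples of [y] (because y i1 = 1), which makes the variation large. *)
Lemma col_var_dichotomy :
  (\sum_i y i ^+ 2) * #|J|.-1%:R <= col_var \/
  #|J|.-1%:R * #|I|.-1%:R <= transverse_var.
Proof.
pose d j k i l := (m i j - m i k) * y l - (m l j - m l k) * y i.
have Zd j k i l : d j k i l \is a Num.int by rewrite rpredB ?rpredM ?rpredB.
(* Two columns have the same label exactly when their difference is proportional to [y]. *)
pose h j : {ffun I * I -> algC} :=
  [ffun il => m il.1 j * y il.2 - m il.2 j * y il.1].
have hE j k : h j != h k -> exists il, d j k il.1 il.2 != 0.
  move=> njk; apply/existsP; apply: contraR njk => /existsPn eqjk.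
  apply/eqP/ffunP=> il; rewrite !ffunE; apply/eqP.
  have /negPn/eqP := eqjk il; rewrite /d => d0; rewrite -subr_eq0 -d0.
  by apply/eqP; ring.
have [/existsP[j /existsP[k hjk]] | /existsPn nh] :=
    boolP [exists j, exists k, h j != h k].
- right; rewrite -(@ler_pMn2r _ 4) // -transverse_varE.
  have -> : #|J|.-1%:R * #|I|.-1%:R *+ 4
            = (2 * #|I|.-1)%:R *+ (2 * #|J|.-1) :> algC.
    by rewrite -natrM -!mulrnA; congr (1 *+ _); lia.
  apply: sum_pairs_ge hjk => // [j' k'|j' k' /hE[[i l] /= dil]].
    by do 2![apply: sumr_ge0 => ? _]; apply: sqr_int_ge0 (Zd j' k' _ _).
  (* For a fixed pair of columns with difference t, the cross term at i, l is nonzero exactly when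
     t_i / y_i and t_l / y_l differ, so the pair count applies a second time, now to the rows. *)
  apply: (@sum_pairs_ge _ _ _ (fun i => (m i j' - m i k') / y i) _ 1 i l) => //.
  - by move=> i' l'; apply: sqr_int_ge0 (Zd _ _ _ _).
  - move=> i' l' neq; apply: sqr_intr_ge1 (Zd j' k' i' l') _.
    by apply: contra neq; rewrite subr_eq0 eqr_div.
  by apply: contra dil; rewrite /d eqr_div // subr_eq0.
left; rewrite -(@ler_pMn2r _ 2) // -col_varE mulr_natr -mulrnA mulnC.
apply: sum_pairs_ge col01 => [|j k|j k /colP[i mi]].
- by apply: sumr_ge0 => i _; apply: sqr_int_ge0.
- by apply: sumr_ge0 => i _; rewrite sqr_int_ge0 ?rpredB.
have prop l : m l j - m l k = (m i1 j - m i1 k) * y l.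
  have /existsPn/(_ k)/negPn/eqP/ffunP/(_ (i1, l)) := nh j.
  rewrite !ffunE /= y1 !mulr1 => /eqP; rewrite -subr_eq0 => /eqP e.
  apply/eqP; rewrite -subr_eq0 -oppr_eq0 -e; apply/eqP; ring.
under [leRHS]eq_bigr do rewrite prop exprMn.
rewrite -mulr_sumr ler_peMl //.
  by apply: sumr_ge0 => l _; apply: sqr_int_ge0.
apply: sqr_intr_ge1; first by rewrite rpredB.
by apply: contraNneq mi => e; rewrite -subr_eq0 prop e mul0r.
Qed.

End ColumnVariation.

(** * Characters restricted to a direct product *)

(** Both sides are |G| times the squared norm of the class function with coefficients [x]. *)
Lemma parseval_irr (gT : finGroupType) (G : {group gT}) (x : Iirr G -> algC) :
  \sum_(g in G) `|\sum_i x i * 'chi_i g| ^+ 2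
    = #|G|%:R * \sum_i `|x i| ^+ 2.
Proof.
have nG : #|G|%:R != 0 :> algC by apply: neq0CG.
pose phi := \sum_i x i *: 'chi[G]_i.
have phiE g : phi g = \sum_i x i * 'chi_i g.
  by rewrite sum_cfunE; apply: eq_bigr => i _; rewrite cfunE.
have -> : \sum_i `|x i| ^+ 2 = '[phi].
  rewrite cfdot_sum_irr; apply: eq_bigr => i _; rewrite normCK.
  suff -> : '[phi, 'chi_i] = x i by [].
  rewrite cfdot_suml (bigD1 i) //= cfdotZl cfdot_irr eqxx mulr1 big1 ?addr0 //.
  by move=> j ji; rewrite cfdotZl cfdot_irr (negPf ji) mulr0.
rewrite (cfnormE (cfun_onG _)) mulVKf //.
by apply: eq_bigr => g _; rewrite phiE.
Qed.

Section DirectProduct.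

Variables (gT : finGroupType) (D A H : {group gT}).
Hypotheses (DxA : D \x A = H) (cAA : abelian A).

Let chiA1 (j : Iirr A) : 'chi_j 1%g = 1.
Proof. by apply/lin_char1/char_abelianP. Qed.

Section Multiplicities.

Variable phi : 'CF(H).
Hypothesis Nphi : phi \is a character.

Definition dprod_mult (i : Iirr D) (j : Iirr A) : algC :=
  '[phi, cfDprod DxA 'chi_i 'chi_j].

Let m := dprod_mult.

Lemma dprod_mult_nat i j : m i j \is a Num.nat.
Proof. by rewrite Cnat_cfdot_char ?cfDprod_char ?irr_char. Qed.

Lemma dprod_mult_int i j : m i j \is a Num.int.
Proof. by rewrite rpred_nat_num ?dprod_mult_nat. Qed.

Lemma cfDprod_decomposition :
  phi = \sum_i \sum_j m i j *: cfDprod DxA 'chi_i 'chi_j.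
Proof.
rewrite pair_bigA {1}[phi]cfun_sum_cfdot /=.
rewrite (reindex (dprod_Iirr DxA)) /=; last first.
  exists (inv_dprod_Iirr DxA) => i _; first exact: dprod_IirrK.
  exact: inv_dprod_IirrK.
by apply: eq_bigr => -[i j] _; rewrite dprod_IirrE.
Qed.

Lemma dprod_valueE : {in D & A, forall d a,
  phi (d * a)%g = \sum_i (\sum_j m i j * 'chi_j a) * 'chi_i d}.
Proof.
move=> d a Dd Aa; rewrite {1}cfDprod_decomposition sum_cfunE.
apply: eq_bigr => i _; rewrite sum_cfunE mulr_suml; apply: eq_bigr => j _.
by rewrite cfunE cfDprodE // -mulrA; congr (_ * _); rewrite mulrC.
Qed.

Let normK (x : algC) : x \is a Num.int -> `|x| ^+ 2 = x ^+ 2.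
Proof. exact: intr_normK. Qed.

Lemma sum_norm_dprod1r :
  \sum_(d in D) `|phi (d * 1)%g| ^+ 2 = #|D|%:R * \sum_i (\sum_j m i j) ^+ 2.
Proof.
under eq_bigr => d Dd do rewrite (dprod_valueE Dd (group1 A)).
rewrite parseval_irr; congr (_ * _); apply: eq_bigr => i _.
under eq_bigr do rewrite chiA1 mulr1.
by rewrite normK // rpred_sum // => j _; apply: dprod_mult_int.
Qed.

(** Parseval on A: the column sum weighted by the degrees is the multiplicity of 'chi_j in the
    restriction of [phi] to A. *)
Lemma sum_norm_dprod1l :
  \sum_(a in A) `|phi (1 * a)%g| ^+ 2
    = #|A|%:R * \sum_j (weighted_col m (fun i => 'chi_i 1%g) j) ^+ 2.
Proof.
transitivity (\sum_(a in A)
  `|\sum_j weighted_col m (fun i => 'chi_i 1%g) j * 'chi_j a| ^+ 2).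
  apply: eq_bigr => a Aa; rewrite dprod_valueE //; congr (`|_| ^+ 2).
  under eq_bigr do rewrite mulr_suml.
  rewrite exchange_big; apply: eq_bigr => j _; rewrite mulr_suml.
  by apply: eq_bigr => i _; rewrite mulrAC.
rewrite parseval_irr; congr (_ * _); apply: eq_bigr => j _.
rewrite normK // rpred_sum // => i _.
by rewrite rpredM ?dprod_mult_int // rpred_nat_num ?Cnat_irr1.
Qed.

Lemma sum_norm_dprod :
  \sum_(a in A) \sum_(d in D) `|phi (d * a)%g| ^+ 2
    = #|D|%:R * (#|A|%:R * \sum_i \sum_j m i j ^+ 2).
Proof.
under eq_bigr => a Aa.
  under eq_bigr => d Dd do rewrite (dprod_valueE Dd Aa).
  rewrite parseval_irr; over.
rewrite -mulr_sumr; congr (_ * _); rewrite exchange_big mulr_sumr.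
apply: eq_bigr => i _; rewrite parseval_irr; congr (_ * _).
by apply: eq_bigr => j _; rewrite normK // dprod_mult_int.
Qed.

Lemma dprod_value1E :
  phi 1%g = \sum_j weighted_col m (fun i => 'chi_i 1%g) j.
Proof.
rewrite -[in LHS](mulg1 1%g) dprod_valueE //.
under eq_bigr do rewrite mulr_suml.
by rewrite exchange_big; do 2![apply: eq_bigr => ? _]; rewrite chiA1 mulr1.
Qed.

(** Parseval on D x A, minus Parseval on D for the term a = 1. *)
Lemma sum_norm_offl :
  \sum_(a in A^#) \sum_(d in D) `|phi (d * a)%g| ^+ 2
    = #|D|%:R * col_var m.
Proof.
have := sum_norm_dprod; rewrite (big_setD1 1%g) //= sum_norm_dprod1r.
move/(canRL (addKr _)) ->; rewrite /col_var card_Iirr_abelian //.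
rewrite sumrB -mulr_sumr; ring.
Qed.

(** The terms d = 1 are removed from [sum_norm_offl] by Parseval on A. The squared degrees sum to
    |D|, which supplies the first factor of [transverse_var]. *)
Lemma sum_norm_off :
  \sum_(a in A^#) \sum_(d in D^#) `|phi (d * a)%g| ^+ 2
    = transverse_var m (fun i => 'chi_i 1%g).
Proof.
have -> : \sum_(a in A^#) \sum_(d in D^#) `|phi (d * a)%g| ^+ 2
    = \sum_(a in A^#) \sum_(d in D) `|phi (d * a)%g| ^+ 2
      - \sum_(a in A^#) `|phi (1 * a)%g| ^+ 2.
  rewrite -sumrB; apply: eq_bigr => a _.
  by rewrite [X in _ = X - _](big_setD1 1%g) //= addrAC subrr add0r.
have := sum_norm_dprod1l; rewrite (big_setD1 1%g) //= mulg1.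
move/(canRL (addKr _)) ->; rewrite sum_norm_offl /transverse_var irr_sum_square.
rewrite card_Iirr_abelian // dprod_value1E normK; first by ring.
rewrite rpred_sum // => j _; rewrite rpred_sum // => i _.
by rewrite rpredM ?dprod_mult_int // rpred_nat_num ?Cnat_irr1.
Qed.

Lemma not_dprod_reg :
    ~ (exists2 tau : 'CF(D), tau \is a character &
         phi = cfDprod DxA tau (cfReg A)) ->
  exists i j0 j1, m i j0 != m i j1.
Proof.
move=> nreg.
have [/existsP[i /existsP[j m0j]] | /existsPn eqm] :=
  boolP [exists i, exists j, m i 0 != m i j]; first by exists i, 0, j.
(* All columns agree, so column 0 gives tau, and rho_A is the sum of all linear characters of A. *)
case: nreg; exists (\sum_i m i 0 *: 'chi_i).
  apply: rpred_sum => i _; have /natrP[n ->] := dprod_mult_nat i 0.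
  by rewrite scaler_nat rpredMn ?irr_char.
rewrite /cfDprod linear_sum mulr_suml [LHS]cfDprod_decomposition.
apply: eq_bigr => i _; rewrite cfReg_sum linear_sum mulr_sumr.
apply: eq_bigr => j _; rewrite chiA1 scale1r linearZ -scalerAl.
by have /existsPn/(_ j)/negPn/eqP -> := eqm i.
Qed.

End Multiplicities.

Variable X : {group gT}.
Hypothesis sHX : H \subset X.

Definition not_restrict_reg (i : Iirr X) : Prop :=
  ~ (exists2 tau : 'CF(D), tau \is a character &
       'Res[H] 'chi_i = cfDprod DxA tau (cfReg A)).

Let m i := dprod_mult ('Res[H] 'chi[X]_i).

(** Once the sums are exchanged, second orthogonality applies at each element da. *)
Let sum_irr_norm (B E : {set gT}) : B \subset D -> E \subset A ->
  \sum_i \sum_(a in E) \sum_(d in B) `|'Res[H] 'chi[X]_i (d * a)%g| ^+ 2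
    = (\sum_(d in B) \sum_(a in E) #|'C_X[d * a]|)%:R.
Proof.
move=> /subsetP sBD /subsetP sEA; rewrite exchange_big natr_sum.
under eq_bigr do rewrite exchange_big /=.
rewrite exchange_big /=; apply: eq_bigr => d Bd; rewrite natr_sum.
apply: eq_bigr => a Ea.
have Hda : (d * a)%g \in H.
  by have [_ <- _ _] := dprodP DxA; rewrite mem_mulg ?sBD ?sEA.
under eq_bigr do rewrite (cfResE _ sHX Hda) normCK.
by rewrite second_orthogonality_relation ?class_refl // (subsetP sHX).
Qed.

Let card_mul_le (Z : {set Iirr X}) (k : nat) (f : Iirr X -> algC) (n : nat) :
    (forall i, 0 <= f i) -> (forall i, i \in Z -> k%:R <= f i) ->
    \sum_i f i = n%:R -> (#|Z| * k <= n)%N.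
Proof.
move=> f0 fZ sumf; rewrite -(ler_nat algC) -sumf natrM mulr_natl -sumr_const.
rewrite [leRHS](bigID [in Z]) /= -[leLHS]addr0 lerD ?sumr_ge0 //.
exact: ler_sum.
Qed.

Let sum_norm_ge0 (phi : 'CF(H)) (B E : {set gT}) :
  0 <= \sum_(a in E) \sum_(d in B) `|phi (d * a)%g| ^+ 2.
Proof. by do 2![apply: sumr_ge0 => ? _]; apply: exprn_ge0. Qed.

Let Zirr1 (i : Iirr D) : 'chi_i 1%g \is a Num.int.
Proof. by rewrite rpred_nat_num ?Cnat_irr1. Qed.

Let NRes i : 'Res[H] 'chi[X]_i \is a character.
Proof. by rewrite cfRes_char ?irr_char. Qed.

(** A trivial A leaves a single column. The inequality allows the factor |A| - 1 to be cancelled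
    below. *)
Lemma not_restrict_reg_card_gt1 i : not_restrict_reg i -> (1 < #|A|)%N.
Proof.
case/(not_dprod_reg (NRes i)) => [i0 [j0 [j1 neq]]].
rewrite -(card_Iirr_abelian cAA); apply/card_gt1P; exists j0, j1.
by split=> //; apply: contraNneq neq => ->.
Qed.

Variables (Z : {set Iirr X}) (f : gT -> nat).
Hypothesis ZP : forall i, i \in Z -> not_restrict_reg i.
Hypothesis cent_le : {in D & A^#, forall d a, (#|'C_X[d * a]| <= f d)%N}.

Let sum_cent_le (B : {set gT}) : B \subset D ->
  (\sum_(d in B) \sum_(a in A^#) #|'C_X[d * a]|
     <= #|A|.-1 * \sum_(d in B) f d)%N.
Proof.
move=> /subsetP sBD; rewrite big_distrr; apply: leq_sum => d Bd /=.
have -> : #|A|.-1 = #|A^#| by rewrite (cardsD1 1%g A) group1.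
by rewrite -sum_nat_const; apply: leq_sum => a Aa; rewrite cent_le ?sBD.
Qed.

(** Each member of [Z] contributes at least |D|(|A| - 1) to the sum over all da with a != 1. As
    [f d] does not depend on a, the factor |A| - 1 cancels. *)
Theorem card_not_restrict_reg_le : (#|Z| * #|D| <= \sum_(d in D) f d)%N.
Proof.
have [->|[i0 Zi0]] := set_0Vmem Z; first by rewrite cards0.
have A1 := not_restrict_reg_card_gt1 (ZP Zi0).
rewrite -(@leq_pmul2l #|A|.-1); last by rewrite -subn1 subn_gt0.
apply: leq_trans (sum_cent_le (subxx _)); rewrite mulnCA.
apply: card_mul_le (sum_irr_norm (subxx _) (subD1set _ _)) => // i.
move/ZP/(not_dprod_reg (NRes i)) => [i1 [j0 [j1 neq]]].
rewrite sum_norm_offl // mulnC natrM ler_wpM2l ?ler0n //.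
rewrite -card_Iirr_abelian //; apply: col_var_ge neq => // *.
exact: dprod_mult_int.
Qed.

Theorem card_not_restrict_reg_split :
  exists n1 n2 : nat, [/\ (#|Z| <= n1 + n2)%N,
    (n1 * #|D| ^ 2 <= \sum_(d in D) f d)%N &
    (n2 * #|classes D|.-1 <= \sum_(d in D^#) f d)%N].
Proof.
have [->|[i0 Zi0]] := set_0Vmem Z; first by exists 0, 0; rewrite cards0.
have A1 := not_restrict_reg_card_gt1 (ZP Zi0).
(* [Z1] collects the first case of the dichotomy and is counted over D; the remaining characters
   have large transverse variation and are counted over D^#. *)
pose Z1 := [set i in Z | #|D|%:R * #|A|.-1%:R <= col_var (m i)].
exists #|Z1|, #|Z :\: Z1|; split.
- rewrite -(cardsID Z1 Z) leq_add2r subset_leq_card //.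
  by rewrite subsetIr.
- rewrite -(@leq_pmul2l #|A|.-1); last by rewrite -subn1 subn_gt0.
  apply: leq_trans (sum_cent_le (subxx _)); rewrite mulnCA.
  apply: card_mul_le (sum_irr_norm (subxx _) (subD1set _ _)) => // i.
  rewrite inE => /andP[_ le1]; rewrite sum_norm_offl //.
  by rewrite mulnC -mulnA natrM ler_wpM2l ?ler0n // natrM.
rewrite -(@leq_pmul2l #|A|.-1); last by rewrite -subn1 subn_gt0.
apply: leq_trans (sum_cent_le (subD1set _ _)); rewrite mulnCA.
apply: card_mul_le (sum_irr_norm (subD1set _ _) (subD1set _ _)) => // i.
rewrite inE => /andP[nZ1 Zi].
have [i1 [j0 [j1 neq]]] := not_dprod_reg (NRes i) (ZP Zi).
have := col_var_dichotomy (m := m i) (y := fun l => 'chi_l 1%g) (i1 := 0)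
  _ Zirr1 (fun l => irr1_neq0 l) _ neq.
have cardD : #|Iirr D|.-1 = #|classes D|.-1 by rewrite card_ord NirrE.
rewrite irr_sum_square (card_Iirr_abelian cAA) sum_norm_off // -cardD natrM.
case=> // [||le1]; first exact: dprod_mult_int.
- by rewrite irr0 cfun11.
by case/negP: nZ1; rewrite inE Zi.
Qed.

End DirectProduct.

(** * Irreducible characters not vanishing on an abelian normal subgroup *)

(** Frobenius modulo p in the ring of algebraic integers: p divides the inner binomial
    coefficients. *)
Lemma exp_sum_prime_Aint (p : nat) (s : seq algC) :
    prime p -> {in s, forall z, z \in Aint} ->
  ((\sum_(z <- s) z) ^+ p == \sum_(z <- s) z ^+ p %[mod p])%A.
Proof.
move=> pr_p; have p_gt0 := prime_gt0 pr_p.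
elim: s => [|z s IHs] Zs; first by rewrite !big_nil expr0n gtn_eqF ?eqAmod_refl.
have Zz : z \in Aint by apply: Zs; rewrite mem_head.
have {}Zs : {in s, forall z, z \in Aint}.
  by move=> x sx; apply: Zs; rewrite in_cons sx orbT.
rewrite !big_cons; set S := \sum_(z <- s) z in IHs *.
have ZS : S \in Aint by rewrite /S big_seq rpred_sum.
apply: (@eqAmod_trans _ (z ^+ p + S ^+ p)); last by rewrite eqAmodDl IHs.
case: p pr_p p_gt0 {IHs} => // q pr_q _.
rewrite exprDn big_ord_recl big_ord_recr /= subn0 expr0 mulr1 bin0 mulr1n.
rewrite /bump /= add1n subnn expr0 mul1r binn mulr1n eqAmodDl.
rewrite -[X in (_ == X %[mod _])%A]add0r eqAmodDr.
rewrite eqAmod0 rpred_sum // => i _ /=.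
have /dvdnP[k ->] : (q.+1 %| 'C(q.+1, bump 0 i))%N.
  by rewrite prime_dvd_bin //= /bump /= add1n ltnS ltn_ord.
rewrite mulrnA -[_ *+ q.+1]mulr_natl -eqAmod0 eqAmodMr0 //.
by rewrite rpredMn ?rpredM ?rpredX.
Qed.

(** The p-th power of the vanishing sum is congruent modulo p to the sum of the p-th powers, which
    counts the terms. *)
Lemma prime_dvd_size_sum_roots (p : nat) (s : seq algC) :
    prime p -> {in s, forall z, z ^+ p = 1} -> \sum_(z <- s) z = 0 ->
  (p %| size s)%N.
Proof.
move=> pr_p s1 s0; rewrite -eqAmod0_nat.
have Zs : {in s, forall z, z \in Aint}.
  move=> z /s1 z1; apply: (Aint_unity_root (prime_gt0 pr_p)).
  exact/unity_rootP.
have := exp_sum_prime_Aint pr_p Zs; rewrite s0 expr0n gtn_eqF ?prime_gt0 //=.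
suff -> : \sum_(z <- s) z ^+ p = (size s)%:R by rewrite eqAmod_sym.
rewrite big_seq (eq_bigr (fun=> 1)) => [|z /s1 //].
by rewrite -big_seq big_const_seq count_predT iter_addr_0.
Qed.

(* By Clifford's theorem the restriction to [N] is a multiple of an orbit sum of
   linear characters, so its vanishing at [x] is a vanishing sum of p-th roots
   of unity, whose number divides #|X : N|. *)
Lemma irr_neq0_prime_index (gT : finGroupType) (X N : {group gT}) (i : Iirr X)
    (x : gT) (p : nat) :
    N <| X -> abelian N -> x \in N -> prime p -> (x ^+ p = 1)%g ->
  ~~ (p %| #|X : N|)%N -> 'chi_i x != 0.
Proof.
move=> nsNX cNN Nx pr_p xp1; apply: contra => /eqP chi0.
have sNX := normal_sub nsNX.
have [|j chi_j] := @neq0_has_constt _ N ('Res 'chi_i).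
  by rewrite Res_irr_neq0.
have := congr1 (fun phi : 'CF(N) => phi x)
  (Clifford_Res_sum_cfclass nsNX chi_j).
rewrite cfResE // chi0 cfunE sum_cfunE => /esym/eqP.
rewrite mulf_eq0 -[X in X || _]negbK -irr_consttE chi_j /= => /eqP sum0.
have: (p %| size [seq phi x | phi : 'CF(N) <- ('chi_j ^: X)%CF])%N.
  apply: prime_dvd_size_sum_roots => // [z|]; last by rewrite big_map.
  move=> /mapP[_ /cfclassP[y Xy ->] ->].
  have lin : ('chi_j ^ y)%CF \is a linear_char.
    by apply: cfConjg_lin_char; apply/char_abelianP.
  by rewrite -(lin_charX lin) // xp1 lin_char1.
rewrite size_map size_cfclass => pT; apply: dvdn_trans pT _.
rewrite -(@Lagrange_index _ X 'I_X['chi_j] N) ?dvdn_mulr ?subsetIl //.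
by rewrite sub_Inertia.
Qed.

(** * Centralizers in semidirect products *)

Section SemidirectCentralizer.

Variables (gT : finGroupType) (V G X : {group gT}) (c u : gT).
Hypotheses (defX : V ><| G = X) (cVV : abelian V) (Gc : c \in G) (Vu : u \in V).

(** The projection of X onto G with kernel V sends cu to c, hence centralizers into centralizers. *)
Lemma cent_sdprod_mul_sub : 'C_X[c * u] \subset (V * 'C_G[c])%g.
Proof.
have [nsVX sGX defVG nVG tiVG] := sdprod_context defX.
have compl : G \in [complements to V in X] by apply/complP.
apply/subsetP=> y /setIP[Xy /cent1P cy].
move: (Xy); rewrite -defVG => /mulsgP[w h Vw Gh def_y].
have Xc : c \in X := subsetP sGX c Gc.
have Xu : u \in X := subsetP (normal_sub nsVX) u Vu.
rewrite def_y mem_mulg // inE Gh; apply/cent1P.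
have := congr1 (remgr V G) cy; rewrite !(remgrM compl nsVX) ?groupM //.
by rewrite def_y (remgrMid tiVG) // (remgr_id tiVG) // remgr1 // mulg1.
Qed.

(** With K the centralizer of cu, |K||V| = |KV||K :&: V|. Here KV lies in VE, and K :&: V
    centralizes c because V is abelian. *)
Lemma card_cent_sdprod_mul_le (E : {group gT}) :
    E \subset G -> 'C_X[c * u] \subset (V * E)%g ->
  (#|'C_X[c * u]| <= #|E| * #|'C_V[c]|)%N.
Proof.
move=> sEG sCVE; have [_ _ _ nVG _] := sdprod_context defX.
rewrite -(leq_pmul2r (cardG_gt0 V)) mul_cardG -mulnAC.
apply: leq_mul; last first.
  rewrite subset_leq_card //; apply/subsetP=> w /setIP[/setIP[_ /cent1P cw] Vw].
  rewrite inE Vw; apply/cent1P; apply: (mulIg u).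
  by rewrite -mulgA cw -!mulgA (centsP cVV w Vw u Vu).
have nVE := subset_trans sEG nVG.
have sub : ('C_X[c * u] * V)%g \subset (V * E)%g.
  apply: subset_trans (mulSg V sCVE) _.
  by rewrite -mulgA (normC nVE) mulgA mulGid.
apply: leq_trans (subset_leq_card sub) _.
rewrite mulnC -(leq_pmul2r (cardG_gt0 (V :&: E)%G)) -mul_cardG.
by rewrite leq_pmulr ?cardG_gt0.
Qed.

Lemma card_cent_sdprod_le : (#|'C_X[c * u]| <= #|'C_G[c]| * #|'C_V[c]|)%N.
Proof. exact: (card_cent_sdprod_mul_le (subsetIl _ _) cent_sdprod_mul_sub). Qed.

(** By coprimeness u is a power of cu, so y = wh in the centralizer of cu also centralizes u; so
    does w, as V is abelian, and hence h. *)
Lemma card_cent_sdprod_coprime_le : commute c u -> coprime #[c] #[u] ->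
  (#|'C_X[c * u]| <= #|'C_('C_G[u])[c]| * #|'C_V[c]|)%N.
Proof.
move=> cuc co_cu; apply: (@card_cent_sdprod_mul_le 'C_('C_G[u])[c]%G) => /=.
  by rewrite -setIA subsetIl.
apply/subsetP=> y Cy.
have /mulsgP[w h Vw /setIP[Gh ch] def_y] := subsetP cent_sdprod_mul_sub y Cy.
rewrite def_y mem_mulg //; apply/setIP; split=> //; apply/setIP; split=> //.
have cuy : u \in 'C[y].
  have : <[c * u]> \subset 'C[y].
    rewrite cycle_subG; have /setIP[_ cy] := Cy; apply/cent1P.
    exact/commute_sym/cent1P.
  rewrite (cycleM cuc co_cu) => /subsetP; apply.
  by apply: subsetP (mulG_subr _ _) _ (cycle_id u).
have -> : h = (w^-1 * y)%g by rewrite def_y mulKg.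
apply: groupM; first by rewrite groupV; apply/cent1P; exact: (centsP cVV).
by apply/cent1P/commute_sym/cent1P.
Qed.

End SemidirectCentralizer.

(** A class K contributes |K||C_C(x)| = |C| times the common value of [f] on K. *)
Lemma sum_class_representatives (gT : finGroupType) (C : {group gT})
    (c : nat -> gT) (f : gT -> nat) :
    class_representatives C c -> {in C &, forall x y, f (x ^ y)%g = f x} ->
  (\sum_(x in C) #|'C_C[x]| * f x
     = #|C| * \sum_(1 <= i < #|classes C|.+1) f (c i))%N.
Proof.
case=> _ cC cP fJ; rewrite big_distrr /=.
transitivity (\sum_(1 <= i < #|classes C|.+1)
    \sum_(x in C | x \in c i ^: C) #|'C_C[x]| * f x)%N; last first.
  apply: eq_big_nat => i ik; have Ci := cC i ik.
  transitivity (\sum_(x in c i ^: C) #|'C_C[c i]| * f (c i))%N.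
    have sub x : x \in c i ^: C -> x \in C.
      by case/imsetP=> y Cy ->; rewrite groupJ.
    apply: eq_big => [x|x /andP[_ /imsetP[y Cy ->]]].
      by apply: andb_idl => /sub.
    rewrite fJ //; congr (_ * _)%N.
    by rewrite -{1}(conjGid Cy) cent1J -conjIg cardJg.
  rewrite sum_nat_const -index_cent1 mulnA [(#|_ : _| * _)%N]mulnC Lagrange //.
  exact: subsetIl.
rewrite [RHS](exchange_big_dep (fun x => x \in C)) /=; last first.
  by move=> ? ? _ /andP[].
apply: eq_bigr => x Cx.
have [i [[ik xi] uniq_i]] := cP x Cx.
rewrite big_nat_cond (eq_bigl (pred1 i)) => [|j].
  by rewrite big_nat1_eq ltnS ik.
rewrite Cx /= andbC; apply/andP/eqP => [[xj jk]|->].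
  by rewrite (uniq_i j).
by rewrite xi ltnS.
Qed.

(** * The subgroups C and A = <v> of GV, and centralizers of their products *)

Section Semidirect.

Variables (gT : finGroupType) (G : {group gT}) (p : nat) (F : fieldType).
Variables (V : finLmodType F) (to : groupAction G [set: V]) (v : V).
Hypothesis charF : p \in [pchar F].

Local Notation V' := (sdpair1 to @* [set: V])%G.
Local Notation G' := (sdpair2 to @* G)%G.
Local Notation X := (semidirect to).
Local Notation C := ('C_G[v | to]).

Let sCG : C \subset G. Proof. exact: subsetIl. Qed.

Let inG x : x \in C -> x \in G. Proof. exact: (subsetP sCG). Qed.

Lemma sdprod_semidirect : V' ><| G' = X.
Proof. exact: sdprod_sdpair. Qed.

Lemma abelian_sdpair1 : abelian V'.
Proof. by apply: morphim_abelian; apply: FinRing.zmod_abelian. Qed.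

Lemma card_sdpair1 : #|V'| = #|[set: V]|.
Proof. by rewrite card_injm ?injm_sdpair1. Qed.

Lemma card_sdpair2 (B : {set gT}) : B \subset G -> #|sdpair2 to @* B| = #|B|.
Proof. by move=> sBG; rewrite card_injm ?injm_sdpair2. Qed.

Lemma card_cent_sdpair2 x :
  x \in G -> #|'C_V'[sdpair2 to x]| = #|'Fix_to[x]|.
Proof.
move=> Gx; rewrite -[RHS](card_injm (injm_sdpair1 to) (subsetT _)).
rewrite -['Fix_to[x]]setTI -gacent1E //= gacentEsd -['C_V'[_]]/(V' :&: _).
by rewrite -[sdpair1 to @*^-1 _]setTI morphim_setIpre morphim_set1 // cent_set1.
Qed.

Lemma stab_inE : stab_in to v = 'C_G'[sdpair1 to v] :> {set _}.
Proof.
by rewrite /stab_in /= astabEsd ?subsetT // morphim_setIpre morphim_set1 ?inE //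
           cent_set1.
Qed.

Lemma cycle_inE : cycle_in to v = <[sdpair1 to v]> :> {set _}.
Proof. by rewrite /cycle_in /= morphim_cycle ?inE. Qed.

Lemma order_vector : v != 0 -> #[v]%g = p.
Proof.
move=> v0; apply: nt_prime_order => //; first exact: pcharf_prime charF.
by rewrite FinRing.zmodXgE -scaler_nat pcharf0 // scale0r.
Qed.

Lemma card_cycle_in : #|cycle_in to v| = #[v]%g.
Proof. by rewrite card_injm ?injm_sdpair1 ?subsetT. Qed.

Lemma cycle_in_abelian : abelian (cycle_in to v).
Proof. by rewrite cycle_inE cycle_abelian. Qed.

Lemma cycle_in_sub : cycle_in to v \subset V'.
Proof. by rewrite morphimS ?subsetT. Qed.

Lemma cycle_in_gen a : a \in (cycle_in to v)^# ->
  <[sdpair1 to v]>%g = <[a]>%g.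
Proof.
(* For v = 0 the set A^# is empty; otherwise A has prime order p. *)
move=> Aa; have [v0 | v0] := eqVneq v 0.
  move: Aa; rewrite cycle_inE v0 -[sdpair1 to 0]/(sdpair1 to 1%g) morph1.
  by rewrite cycle1 => /setD1P[/eqP a1 /set1P a_1]; case: a1.
rewrite -cycle_inE; apply: nt_gen_prime Aa.
by rewrite card_cycle_in order_vector // (pcharf_prime charF).
Qed.

Lemma cent_cycle_in a : a \in (cycle_in to v)^# -> 'C_G'[a] = stab_in to v.
Proof. by move=> Aa; rewrite stab_inE -!cent_cycle (cycle_in_gen Aa). Qed.

Lemma stab_cycle_commute : {in stab_in to v & cycle_in to v, forall d a,
  commute d a}.
Proof.
have [_ _ cAD _] := dprodP (stab_cycle_dprod to v) => d a Dd Aa.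
by apply/commute_sym; apply: (centsP cAD).
Qed.

Lemma sub_stab_in : stab_in to v \subset G'.
Proof. by rewrite stab_inE subsetIl. Qed.

(** Serves (c) at the nontrivial elements of <g>, whose order may be p. *)
Lemma card_cent_stab_le : {in stab_in to v & (cycle_in to v)^#, forall d a,
  (#|'C_X[d * a]| <= #|'C_G'[d]| * #|'C_V'[d]|)%N}.
Proof.
move=> d a Dd /setD1P[_ Aa].
apply: card_cent_sdprod_le sdprod_semidirect abelian_sdpair1 _ _.
  exact: subsetP sub_stab_in d Dd.
exact: subsetP cycle_in_sub a Aa.
Qed.

(** Serves (a) on all of C, and (c) at d = 1. *)
Lemma card_cent_stab_coprime_le : {in stab_in to v & (cycle_in to v)^#,
  forall d a, coprime #[d] #[a] ->
  (#|'C_X[d * a]| <= #|'C_(stab_in to v)[d]| * #|'C_V'[d]|)%N}.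
Proof.
move=> d a Dd Aa co; rewrite -(cent_cycle_in Aa).
have /setD1P[_ A_a] := Aa.
apply: card_cent_sdprod_coprime_le sdprod_semidirect abelian_sdpair1 _ _ _ co.
- exact: subsetP sub_stab_in d Dd.
- exact: subsetP cycle_in_sub a A_a.
exact: stab_cycle_commute.
Qed.

Lemma card_stab_in : #|stab_in to v| = #|C|.
Proof. exact: card_sdpair2. Qed.

Lemma card_classes_stab_in : #|classes (stab_in to v)| = #|classes C|.
Proof.
rewrite /stab_in /= classes_morphim // card_in_imset // => K1 K2.
have sub (K : {set gT}) : K \in classes C -> K \subset G.
  by case/imsetP=> x Cx ->; apply: subset_trans (class_subG Cx _) sCG.
by move=> /sub sK1 /sub sK2; apply: (injm_morphim_inj (injm_sdpair2 to)).
Qed.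

Lemma card_fixJ : {in C &, forall x y,
  #|'Fix_to[(x ^ y)%g]| = #|'Fix_to[x]|}.
Proof.
move=> x y Cx Cy; rewrite -!card_cent_sdpair2 ?groupJ ?inG //.
have [_ _ _ nVG _] := sdprod_context sdprod_semidirect.
have nVy : sdpair2 to y \in 'N(V').
  by rewrite (subsetP nVG) // mem_morphim ?inG.
by rewrite morphJ ?inG // cent1J -[X in #|X :&: _|](normP nVy) -conjIg cardJg.
Qed.

Lemma sum_stab_in (B : {set gT}) : B \subset C ->
  (\sum_(d in sdpair2 to @* B) #|'C_(stab_in to v)[d]| * #|'C_V'[d]|
     = \sum_(x in B) #|'C_C[x]| * #|'Fix_to[x]|)%N.
Proof.
move=> sBC; have sBG := subset_trans sBC sCG.
rewrite morphimEsub // big_imset; last first.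
  by apply: sub_in2 (injmP (injm_sdpair2 to)); apply/subsetP.
apply: eq_bigr => x Bx; have Cx := subsetP sBC x Bx.
by rewrite card_cent_sdpair2 ?inG // -injm_subcent1 ?injm_sdpair2 ?inG //
           card_sdpair2 // subIset ?sCG.
Qed.

Lemma Irr0_not_restrict_reg i :
  i \in Irr0 to v -> not_restrict_reg (stab_cycle_dprod to v) i.
Proof. by rewrite inE => /asboolPn. Qed.

(** * The bounds of (a), with |C| and |V| coprime *)

Section CoprimeStabilizer.

Variable c : nat -> gT.
Hypotheses (reps : class_representatives C%G c).
Hypothesis coCV : coprime #|C| #|[set: V]|.

Let cent_le : {in stab_in to v & (cycle_in to v)^#, forall d a,
  (#|'C_X[d * a]| <= #|'C_(stab_in to v)[d]| * #|'C_V'[d]|)%N}.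
Proof.
move=> d a Dd Aa; apply: card_cent_stab_coprime_le => //.
apply: coprime_dvdl (order_dvdG Dd) _; rewrite card_stab_in.
have /setD1P[_ A_a] := Aa.
have V'a : a \in V' := subsetP cycle_in_sub a A_a.
by apply: coprime_dvdr (order_dvdG V'a) _; rewrite card_sdpair1.
Qed.

Let sum_fix : (\sum_(x in C) #|'C_C[x]| * #|'Fix_to[x]|
  = #|C| * \sum_(1 <= i < #|classes C|.+1) #|'Fix_to[c i]|)%N.
Proof. exact: sum_class_representatives reps card_fixJ. Qed.

Lemma card_Irr0_le :
  (#|Irr0 to v| <= \sum_(1 <= i < #|classes C|.+1) #|'Fix_to[c i]|)%N.
Proof.
rewrite -(@leq_pmul2l #|C|) ?cardG_gt0 // -sum_fix -sum_stab_in // mulnC.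
have := card_not_restrict_reg_le cycle_in_abelian (subsetT _)
  Irr0_not_restrict_reg cent_le.
by rewrite card_stab_in.
Qed.

Lemma card_Irr0_split : exists n1 n2 : nat, [/\ (#|Irr0 to v| <= n1 + n2)%N,
  (n1 * #|C| <= \sum_(1 <= i < #|classes C|.+1) #|'Fix_to[c i]|)%N &
  (n2 * #|classes C|.-1
     <= #|C| * \sum_(2 <= i < #|classes C|.+1) #|'Fix_to[c i]|)%N].
Proof.
have [n1 [n2 [le12 le1 le2]]] := card_not_restrict_reg_split
  cycle_in_abelian (subsetT _) Irr0_not_restrict_reg cent_le.
exists n1, n2; split=> //.
  rewrite -(@leq_pmul2l #|C|) ?cardG_gt0 // -sum_fix -sum_stab_in //.
  by apply: leq_trans le1; rewrite card_stab_in mulnCA.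
move: le2; rewrite card_classes_stab_in => /leq_trans; apply.
have -> : (stab_in to v)^# = sdpair2 to @* C^#.
  by rewrite (injmD1 (injm_sdpair2 to)).
rewrite sum_stab_in ?subD1set //.
(* Adding the term of the identity, which is [c 1], completes both sums, over C^# and from index 2,
   so that [sum_fix] applies. *)
rewrite -(leq_add2l (#|'C_C[c 1%N]| * #|'Fix_to[c 1%N]|)).
have [c1 _ _] := reps.
rewrite {1 2}c1.
rewrite -(big_setD1 1%g (F := fun x => #|'C_C[x]| * #|'Fix_to[x]|)%N) //=.
rewrite sum_fix big_ltn ?ltnS ?classes_gt0 //.
by rewrite mulnDr c1 cent11T setIT.
Qed.

End CoprimeStabilizer.

(** A character tau x rho_A vanishes at v != 0, whereas chi(v) is nonzero because V has index |G|,
    prime to p, in GV. *)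
Lemma Irr0_coprime : v != 0 -> coprime #|G| #|[set: V]| ->
  Irr0 to v = [set: Iirr X].
Proof.
move=> v0 coGV; apply/setP=> i; rewrite !inE; apply/asboolPn => -[tau _ eqi].
have A_v : sdpair1 to v \in cycle_in to v by rewrite cycle_inE cycle_id.
have pr_p := pcharf_prime charF; have ord_v := order_vector v0.
have V'v : sdpair1 to v \in V' by rewrite mem_morphim ?inE.
have v1 : sdpair1 to v != 1%g.
  by rewrite morph_injm_eq1 ?injm_sdpair1 ?inE.
have [nsVX _ _ _ _] := sdprod_context sdprod_semidirect.
have := irr_neq0_prime_index i nsVX abelian_sdpair1 V'v pr_p.
case/(_ _ _)/negP.
- by rewrite -morphX ?inE // -ord_v expg_order morph1.
- have -> : #|X : V'| = #|G|.
    rewrite -divgS ?(normal_sub nsVX) // -(sdprod_card sdprod_semidirect).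
    by rewrite mulKn ?cardG_gt0 // card_sdpair2.
  rewrite -prime_coprime // coprime_sym; apply: coprime_dvdr coGV.
  by rewrite -ord_v order_dvdG ?inE.
have H_v : sdpair1 to v \in stab_in to v <*> cycle_in to v.
  by rewrite mem_gen // inE A_v orbT.
rewrite -(cfResE _ (subsetT (stab_in to v <*> cycle_in to v)) H_v) eqi.
by rewrite -[sdpair1 to v]mul1g cfDprodE // cfRegE (negPf v1) mulr0.
Qed.

(** A restriction m rho_A would give the degree mp. *)
Lemma Irr_p'_not_regular : v != 0 ->
  Irr_p' X p \subset Irr_not_regular to v.
Proof.
move=> v0; apply/subsetP=> i; rewrite !inE; apply: contra => /asboolP[m eqm].
have := congr1 (fun phi : 'CF(cycle_in to v) => phi 1%g) eqm.
rewrite cfRes1 => ->; rewrite -scaler_int cfunE cfRegE eqxx mulr1n.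
by rewrite card_cycle_in (order_vector v0) dvdC_mull ?rpred_int.
Qed.

(** The count is applied to D = <g>: its identity and its q - 1 generators give the two terms. *)
Lemma Irr_not_regular_le (g : gT) (q : nat) :
    g \in C -> #[g]%g = q -> prime q ->
  (q * class_number_at to v
     <= #|'N_G(<[v]> | to)| * #|[set: V]|
        + q.-1 * (p * #|'N_G(<[g]>)| * #|'Fix_to[g]|))%N.
Proof.
move=> Cg og pr_q; have Gg := inG Cg.
have Gg' : sdpair2 to g \in G' by rewrite mem_morphim.
pose D := (sdpair2 to @* <[g]>)%G.
have oD : #|D| = q by rewrite card_sdpair2 ?cycle_subG.
have sD : D \subset stab_in to v by rewrite morphimS ?cycle_subG.
have DxA : D \x cycle_in to v = D <*> cycle_in to v.
  have [_ _ cAD tiAD] := dprodP (stab_cycle_dprod to v).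
  rewrite dprodEY //; first exact: subset_trans cAD (centS sD).
  by apply/trivgP; rewrite -tiAD setSI.
set a := (_ * #|[set: V]|)%N; set b := (p * _ * _)%N.
(* At d = 1 the coprime estimate holds, and C_G(v) lies in N_G(<v>). At a generator d of <g> the
   general estimate is used, with C_G(d) = C_G(g) inside N_G(<g>) and p >= 1. *)
pose f (d : sdprod_by to) := if d == 1%g then a else b.
have cent_le : {in D & (cycle_in to v)^#, forall d x,
    (#|'C_X[d * x]| <= f d)%N}.
  move=> d x Dd Ax; have Sd := subsetP sD d Dd; rewrite /f.
  case: eqVneq => [d1 | nt_d].
    rewrite d1; apply: leq_trans (card_cent_stab_coprime_le _ Ax _) _ => //.
      by rewrite order1 coprime1n.
    rewrite !cent11T !setIT card_stab_in card_sdpair1 /a leq_mul2r.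
    apply/orP; right; apply: subset_leq_card; apply: setIS.
    by rewrite -(astab_gen _ (subsetT [set v])) astab_sub.
  have eqD : <[sdpair2 to g]>%g = <[d]>%g.
    rewrite -morphim_cycle //; apply: nt_gen_prime; first by rewrite oD.
    by rewrite !inE nt_d.
  apply: leq_trans (card_cent_stab_le Sd Ax) _.
  rewrite -[X in (#|_ :&: X| * _)%N]cent_cycle.
  rewrite -[X in (_ * #|_ :&: X|)%N]cent_cycle.
  rewrite -eqD !cent_cycle card_cent_sdpair2 // /b leq_mul2r; apply/orP; right.
  rewrite -injm_subcent1 ?injm_sdpair2 // card_sdpair2 ?subsetIl //.
  apply: leq_trans (leq_pmull _ (prime_gt0 (pcharf_prime charF))).
  by rewrite subset_leq_card // setIS // -cent_cycle cent_sub.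
(* A restriction tau x rho_A to D x A would restrict further to tau(1) rho_A on A. *)
have ZP i : i \in Irr_not_regular to v -> not_restrict_reg DxA i.
  rewrite inE => /asboolPn nreg [tau Ntau eqi]; apply: nreg.
  have /natrP[n tau1] := Cnat_char1 Ntau; exists n%:Z.
  rewrite -(cfResRes _ (joing_subr D _) (subsetT _)) eqi cfDprod_Resr tau1.
  by rewrite scaler_nat.
have := card_not_restrict_reg_le cycle_in_abelian (subsetT _) ZP cent_le.
rewrite oD mulnC => /leq_trans; apply.
rewrite (big_setD1 1%g) //= /f eqxx leq_add2l.
rewrite (eq_bigr (fun=> b)) => [|d /setD1P[/negPf -> //]].
by rewrite sum_nat_const -oD [in leqRHS](cardsD1 1%g) group1.
Qed.

End Semidirect.

(** * Assembly of the bounds over the rationals *)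

Lemma ler_max_split (R : realFieldType) (N n1 n2 m k s1 s2 : nat) :
    (0 < m)%N -> (1 < k)%N -> (N <= n1 + n2)%N ->
    (n1 * m <= s1)%N -> (n2 * k.-1 <= m * s2)%N ->
  N%:R <= Num.max (2 / m%:R * s1%:R) (2 * m%:R / (k%:R - 1) * s2%:R) :> R.
Proof.
case: k => // k m0 k0 leN le1 le2.
have {}m0 : 0 < m%:R :> R by rewrite ltr0n.
have {}k0 : 0 < k%:R :> R by rewrite ltr0n.
have {}leN : N%:R <= n1%:R + n2%:R :> R by rewrite -natrD ler_nat.
have {}le1 : n1%:R <= s1%:R / m%:R :> R.
  by rewrite ler_pdivlMr // -natrM ler_nat.
have {}le2 : n2%:R <= m%:R * s2%:R / k%:R :> R.
  by rewrite ler_pdivlMr // -!natrM ler_nat.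
have -> : k.+1%:R - 1 = k%:R :> R by rewrite -natr1 addrK.
have -> : 2 / m%:R * s1%:R = 2 * (s1%:R / m%:R) :> R by rewrite mulrAC mulrA.
have -> : 2 * m%:R / k%:R * s2%:R = 2 * (m%:R * s2%:R / k%:R) :> R by ring.
rewrite le_max; set x := s1%:R / _ in le1 *; set y := _ / _ in le2 *.
(* A sum of two terms is at most twice the larger, whence the factors 2. *)
by case: (lerP x y) => xy; apply/orP; [right | left]; lra.
Qed.

(** The condition v != 0 appears in (b) and in the first inequality of (c) because for v = 0 the
    group <v> is trivial: every restriction is then of regular form, and both [Irr0] and
    [Irr_not_regular] are empty. *)
Theorem theorem3p3 (gT : finGroupType) (G : {group gT}) (p : nat)
    (F : fieldType) (charF : p \in [pchar F]) (V : finLmodType F)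
    (to : groupAction G [set: V]) (linV : acts_linearly to)
    (faithfulV : [faithful G, on [set: V] | to]) (v : V) (c : nat -> gT)
    (reps : class_representatives 'C_G[v | to]%G c) :
  let C : {group gT} := 'C_G[v | to]%G in
  let kC : nat := #|classes C| in
  let GV := semidirect to in
  let first_bound : rat :=
    \sum_(1 <= i < kC.+1) #|'Fix_to[c i]|%:R in
  let second_bound : rat :=
    Num.max
      (2 / #|C|%:R * \sum_(1 <= i < kC.+1) #|'Fix_to[c i]|%:R)
      (2 * #|C|%:R / (kC%:R - 1)
         * \sum_(2 <= i < kC.+1) #|'Fix_to[c i]|%:R) in
  [/\ (* (a) *)
      coprime #|C| #|[set: V]| ->
        #|Irr0 to v|%:R <= first_bound
        /\ (1%G \proper C -> #|Irr0 to v|%:R <= second_bound),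
      (* (b) *)
      v != 0 -> coprime #|G| #|[set: V]| ->
        [/\ Irr0 to v = [set: Iirr GV],
            #|classes GV| = #|Irr0 to v|,
            #|classes GV|%:R <= first_bound &
            1%G \proper C -> #|classes GV|%:R <= second_bound] &
      (* (c) *)
      forall (g : gT) (q : nat), g \in C -> #[g] = q -> prime q ->
        (v != 0 -> (#|Irr_p' GV p| <= class_number_at to v)%N)
        /\ (class_number_at to v)%:R
             <= q%:R^-1 * (#|'N_G(<[v]> | to)|%:R * #|[set: V]|%:R
                           + (q%:R - 1) * p%:R
                             * #|'N_G(<[g]>)|%:R * #|'Fix_to[g]|%:R) :> rat].
Proof.
move=> C kC GV first_bound second_bound.
have first_le : coprime #|C| #|[set: V]| -> #|Irr0 to v|%:R <= first_bound.
  by move=> co; rewrite /first_bound -natr_sum ler_nat (card_Irr0_le charF).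
have second_le : coprime #|C| #|[set: V]| -> 1%G \proper C ->
    #|Irr0 to v|%:R <= second_bound.
  move=> co ntC; have [n1 [n2 [le12 le1 le2]]] := card_Irr0_split charF reps co.
  rewrite /second_bound -!natr_sum; apply: ler_max_split le12 le1 le2 => //.
  by rewrite classes_gt1 -proper1G.
split=> [co | v0 coGV | g q Cg og pr_q].
- by split=> [|ntC]; [apply: first_le | apply: second_le].
- have coCV : coprime #|C| #|[set: V]|.
    by apply: coprime_dvdl coGV; rewrite cardSg ?subsetIl.
  have Irr0T : Irr0 to v = [set: Iirr GV].
    by apply: Irr0_coprime charF v0 coGV.
  have cardGV : #|classes GV| = #|Irr0 to v|.
    by rewrite Irr0T cardsT card_ord NirrE.
  by rewrite cardGV; split=> // [|ntC]; [apply: first_le | apply: second_le].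
split=> [v0|].
  by rewrite subset_leq_card ?Irr_p'_not_regular.
have q0 : 0 < q%:R :> rat by rewrite ltr0n prime_gt0.
rewrite mulrC ler_pdivlMr // mulrC -!mulrA.
have -> : q%:R - 1 = q.-1%:R :> rat by rewrite -subn1 natrB ?prime_gt0.
rewrite -!natrM -natrD ler_nat !mulnA -mulnA.
by have := Irr_not_regular_le charF Cg og pr_q; rewrite !mulnA.
Qed.
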